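(* Let $G$ be an undirected graph on the vertex set $\{0,1,\dots,n\}$ and let $\mathbb{K}$ be a field. The monomials $x^b=x_1^{b_1}\cdots x_n^{b_n}$, where $b$ ranges over $G$-parking functions, form a linear basis of the algebra $\mathcal{B}_G$. Consequently the Hilbert series of $\mathcal{A}_G$ and $\mathcal{B}_G$ coincide termwise, both algebras are finite-dimensional over $\mathbb{K}$, and $\dim\mathcal{A}_G=\dim\mathcal{B}_G=N_G$, the number of spanning trees of $G$.
   Context: The graph $G$ may have multiple edges and loops; $a_{ij}=a_{ji}$ is the number of edges joining $i$ and $j$. For $I\subseteq\{1,\dots,n\}$ and $i\in I$, $d_I(i)=\sum_{j\in\{0,\dots,n\}\setminus I}a_{ij}$, and $D_I=\sum_{i\in I,\,j\notin I}a_{ij}=\sum_{i\in I}d_I(i)$ (with $j$ ranging over $\{0,\dots,n\}\setminus I$). A sequence $b=(b_1,\dots,b_n)$ of non-negative integers is a $G$-parking function if for every nonempty $I\subseteq\{1,\dots,n\}$ there exists $i\in I$ with $b_i<d_I(i)$. Let $\mathcal{I}_G\subset\mathbb{K}[x_1,\dots,x_n]$ be the ideal generated by the monomials $m_I=\prod_{i\in I}x_i^{d_I(i)}$ and $\mathcal{J}_G$ the ideal generated by $p_I=(\sum_{i\in I}x_i)^{D_I}$, where $I$ ranges over all nonempty subsets of $\{1,\dots,n\}$. Set $\mathcal{A}_G=\mathbb{K}[x_1,\dots,x_n]/\mathcal{I}_G$ and $\mathcal{B}_G=\mathbb{K}[x_1,\dots,x_n]/\mathcal{J}_G$, graded by degree;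 the Hilbert series of a graded algebra $\mathcal{A}=\bigoplus_k\mathcal{A}^k$ is $\sum_k q^k\dim\mathcal{A}^k$. A spanning tree of $G$ is a connected subgraph without cycles containing all vertices.
   Formalization: The claims involving B_G (basis, equal Hilbert series, dimension) are stated for K of characteristic 0, since they fail in characteristic p (e.g. the triangle with p = 2 gives dim B_G = 4, N_G = 3); finite dimension of A_G and dim A_G = N_G hold over any field. *)

(* Defs.v *)
From HB Require Import structures.
From mathcomp Require Import all_boot all_order all_algebra.
From mathcomp Require Import generic_quotient ring_quotient.
From mathcomp Require Import boolp.
From mathcomp Require Import mpoly.

Set Implicit Arguments.
Unset Strict Implicit.
Unset Printing Implicit Defensive.

Import GRing.Theory.

Local Open Scope ring_scope.
Local Open Scope quotient_scope.

Section LinearAlgebra.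
Variables (K : fieldType) (V : lmodType K).

Definition lin_indep (I : eqType) (F : I -> V) : Prop :=
  forall (s : seq I) (c : I -> K), uniq s ->
    \sum_(i <- s) c i *: F i = 0 -> forall i, i \in s -> c i = 0.

Definition in_span (I : eqType) (F : I -> V) (v : V) : Prop :=
  exists (s : seq I) (c : I -> K), v = \sum_(i <- s) c i *: F i.

Definition basis_on (U : V -> Prop) (I : eqType) (F : I -> V) : Prop :=
  [/\ forall i, U (F i), lin_indep F & forall v, U v -> in_span F v].

Definition has_dim (U : V -> Prop) (d : nat) : Prop :=
  exists F : 'I_d -> V, basis_on U F.

Definition fin_dim (U : V -> Prop) : Prop := exists d, has_dim U d.

Definition whole : V -> Prop := fun=> True.

End LinearAlgebra.

Arguments whole {K} V.

(* The quotient of a commutative algebra by the ideal generated by a finite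
   family. The ideal may be the unit ideal (this happens below when the graph
   is disconnected), so the quotient ring may be zero: it can only be a
   comPzRingType and an lmodType, not an lalgType. *)
Section QuotientAlgebra.
Variables (K : fieldType) (A : comAlgType K).
Variables (I : finType) (P : pred I) (g : I -> A).

Definition gen_ideal : {pred A} :=
  fun f => `[< exists c : I -> A, f = \sum_(i | P i) c i * g i >].

Lemma gen_idealP f :
  reflect (exists c : I -> A, f = \sum_(i | P i) c i * g i) (f \in gen_ideal).
Proof. exact: asboolP. Qed.

Lemma gen_ideal_zmod_closed : zmod_closed gen_ideal.
Proof.
split=> [|f h /gen_idealP[c ->] /gen_idealP[d ->]]; apply/gen_idealP.
  by exists (fun=> 0); rewrite big1 // => i _; rewrite mul0r.
exists (fun i => c i - d i); rewrite -sumrB.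
by apply: eq_bigr => i _; rewrite mulrBl.
Qed.

HB.instance Definition _ :=
  GRing.isZmodClosed.Build A gen_ideal gen_ideal_zmod_closed.

Lemma gen_idealM a f : f \in gen_ideal -> a * f \in gen_ideal.
Proof.
case/gen_idealP=> c ->; apply/gen_idealP; exists (fun i => a * c i).
by rewrite mulr_sumr; apply: eq_bigr => i _; rewrite mulrA.
Qed.

Definition quot_alg : Type := Quotient.quot gen_ideal.

HB.instance Definition _ := GRing.Zmodule.on quot_alg.

Definition quot_pi (f : A) : quot_alg := \pi_(Quotient.quot gen_ideal) f.

Lemma quot_pi_eq f h : (quot_pi f == quot_pi h) = (f - h \in gen_ideal).
Proof. by rewrite Quotient.idealrBE. Qed.

Lemma quot_pi_surj x : exists f, x = quot_pi f.
Proof. by exists (repr (x : Quotient.quot gen_ideal)); rewrite /quot_pi reprK. Qed.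

Fact quot_pi_zmod_morphism : zmod_morphism quot_pi.
Proof. exact: (raddfB \pi_(Quotient.quot gen_ideal)). Qed.

HB.instance Definition _ :=
  GRing.isZmodMorphism.Build A quot_alg quot_pi quot_pi_zmod_morphism.

Let rep (x : quot_alg) : A := repr (x : Quotient.quot gen_ideal).

Let repK x : quot_pi (rep x) = x. Proof. exact: reprK. Qed.

Definition quot_one : quot_alg := quot_pi 1.
Definition quot_mul (x y : quot_alg) : quot_alg := quot_pi (rep x * rep y).
Definition quot_scale (a : K) (x : quot_alg) : quot_alg := quot_pi (a *: rep x).

Lemma quot_mulE f h : quot_mul (quot_pi f) (quot_pi h) = quot_pi (f * h).
Proof.
have repB k : rep (quot_pi k) - k \in gen_ideal by rewrite -quot_pi_eq repK.
apply/eqP; rewrite quot_pi_eq.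
rewrite -[_ * _](addrNK (rep (quot_pi f) * h)) -mulrBr -addrA -mulrBl.
by rewrite rpredD //; [|rewrite mulrC]; apply: gen_idealM.
Qed.

Lemma quot_scaleE a f : quot_scale a (quot_pi f) = quot_pi (a *: f).
Proof.
apply/eqP; rewrite quot_pi_eq -scalerBr -mulr_algl gen_idealM //.
by rewrite -quot_pi_eq repK.
Qed.

Fact quot_mulA : associative quot_mul.
Proof.
by move=> x y z; rewrite -[x]repK -[y]repK -[z]repK !quot_mulE mulrA.
Qed.

Fact quot_mulC : commutative quot_mul.
Proof. by move=> x y; rewrite -[x]repK -[y]repK !quot_mulE mulrC. Qed.

Fact quot_mul1 : left_id quot_one quot_mul.
Proof. by move=> x; rewrite -[x]repK quot_mulE mul1r. Qed.

Fact quot_mulDl : left_distributive quot_mul +%R.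
Proof.
move=> x y z; rewrite -[x]repK -[y]repK -[z]repK.
by rewrite -raddfD !quot_mulE mulrDl raddfD.
Qed.

HB.instance Definition _ := GRing.Zmodule_isComPzRing.Build quot_alg
  quot_mulA quot_mulC quot_mul1 quot_mulDl.

Fact quot_scaleA a b x : quot_scale a (quot_scale b x) = quot_scale (a * b) x.
Proof. by rewrite -[x]repK !quot_scaleE scalerA. Qed.

Fact quot_scale1 : left_id 1 quot_scale.
Proof. by move=> x; rewrite -[x]repK quot_scaleE scale1r. Qed.

Fact quot_scaleDr : right_distributive quot_scale +%R.
Proof.
move=> a x y; rewrite -[x]repK -[y]repK.
by rewrite -raddfD !quot_scaleE scalerDr raddfD.
Qed.

Fact quot_scaleDl x : {morph quot_scale^~ x : a b / a + b}.
Proof. by move=> a b; rewrite -[x]repK !quot_scaleE scalerDl raddfD. Qed.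

HB.instance Definition _ := GRing.Zmodule_isLmodule.Build K quot_alg
  quot_scaleA quot_scale1 quot_scaleDr quot_scaleDl.

Fact quot_pi_monoid_morphism : monoid_morphism quot_pi.
Proof. by split=> // f h; rewrite -quot_mulE. Qed.

HB.instance Definition _ :=
  GRing.isMonoidMorphism.Build A quot_alg quot_pi quot_pi_monoid_morphism.

Fact quot_pi_scalable : scalable quot_pi.
Proof. by move=> a f; rewrite -quot_scaleE. Qed.

HB.instance Definition _ :=
  GRing.isScalable.Build K A quot_alg *:%R quot_pi quot_pi_scalable.

Lemma quot_scaleAl (a : K) (x y : quot_alg) : a *: (x * y) = (a *: x) * y.
Proof.
have [f ->] := quot_pi_surj x; have [h ->] := quot_pi_surj y.
by rewrite -rmorphM -!linearZ -rmorphM -scalerAl.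
Qed.

End QuotientAlgebra.

Section Grading.
Variables (K : fieldType) (n : nat).
Variables (I : finType) (P : pred I) (g : I -> {mpoly K[n]}).

(* For homogeneous g, the degree k component of the quotient. *)
Definition graded_piece (k : nat) (v : quot_alg P g) : Prop :=
  exists2 f : {mpoly K[n]}, f \is k.-homog & v = quot_pi P g f.

(* h is the coefficient sequence of the Hilbert series. *)
Definition hilbert_series (h : nat -> nat) : Prop :=
  forall k, has_dim (graded_piece k) (h k).

End Grading.

(* An edge e joins u and v when ends e = [set u; v]; loops are the edges with a
   single end, and parallel edges are distinct elements of edge. *)
Record multigraph (n : nat) := Multigraph {
  edge : finType;
  ends : edge -> {set 'I_n.+1};
  card_ends : forall e, (0 < #|ends e| <= 2)%N
}.

Section Graph.
Variables (n : nat) (G : multigraph n).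

Definition mult (i j : 'I_n.+1) : nat :=
  #|[set e : edge G | ends e == [set i; j]]|.

(* The index i : 'I_n stands for the vertex i + 1, i.e. lift ord0 i. *)
Definition vtx (i : 'I_n) : 'I_n.+1 := lift ord0 i.

Definition dout (I : {set 'I_n}) (i : 'I_n) : nat :=
  (\sum_(j : 'I_n.+1 | j \notin vtx @: I) mult (vtx i) j)%N.

Definition Dout (I : {set 'I_n}) : nat := (\sum_(i in I) dout I i)%N.

Definition is_parking (b : 'X_{1..n}) : bool :=
  [forall I : {set 'I_n}, (I != set0) ==> [exists i in I, (b i < dout I i)%N]].

Definition parking : Type := {b : 'X_{1..n} | is_parking b}.

HB.instance Definition _ := SubChoice.on parking.

Definition adj (T : {set edge G}) : rel 'I_n.+1 :=
  fun u v => [exists e in T, ends e == [set u; v]].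

Definition connected_sub (T : {set edge G}) : bool :=
  [forall u, forall v, connect (adj T) u v].

(* A cycle of length k + 1: distinct vertices v_0, ..., v_k and distinct edges
   e_0, ..., e_k with e_i joining v_i and v_(i + 1 mod k + 1). A loop is a cycle
   of length 1 and two parallel edges form a cycle of length 2; the length is
   at most n + 1 because the vertices are distinct. *)
Definition has_cycle (T : {set edge G}) : bool :=
  [exists k : 'I_n.+1,
   exists v : {ffun 'I_k.+1 -> 'I_n.+1}, exists e : {ffun 'I_k.+1 -> edge G},
     [&& injectiveb v, injectiveb e, [forall i, e i \in T]
       & [forall i, ends (e i) == [set v i; v (ordS i)]]]].

(* A subgraph containing all the vertices is determined by its edges. *)
Definition is_spanning_tree (T : {set edge G}) : bool :=
  connected_sub T && ~~ has_cycle T.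

Definition num_spanning_trees : nat := #|[set T | is_spanning_tree T]|.

Section Algebras.
Variable K : fieldType.

Definition nonempty : pred {set 'I_n} := fun I => I != set0.

Definition mI (I : {set 'I_n}) : {mpoly K[n]} :=
  \prod_(i in I) 'X_i ^+ dout I i.

Definition pI (I : {set 'I_n}) : {mpoly K[n]} :=
  (\sum_(i in I) 'X_i) ^+ Dout I.

Definition algA := quot_alg nonempty mI.
Definition algB := quot_alg nonempty pI.

HB.instance Definition _ := GRing.ComPzRing.on algA.
HB.instance Definition _ := GRing.Lmodule.on algA.
HB.instance Definition _ := GRing.ComPzRing.on algB.
HB.instance Definition _ := GRing.Lmodule.on algB.

Definition parking_monomial (b : parking) : algB :=
  quot_pi nonempty pI 'X_[val b].

Definition hilbert_series_A : (nat -> nat) -> Prop :=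
  hilbert_series nonempty mI.
Definition hilbert_series_B : (nat -> nat) -> Prop :=
  hilbert_series nonempty pI.

End Algebras.
End Graph.

(* Main.v *)
Require Import Defs.
From HB Require Import structures.
From mathcomp Require Import all_boot all_order all_algebra.
From mathcomp Require Import mpoly.

Set Implicit Arguments.
Unset Strict Implicit.
Unset Printing Implicit Defensive.

Import GRing.Theory.

(** Deletion and contraction of an edge e joining a vertex i to the root govern
    everything. Contracting vertices into the root and deleting edges leads to
    pairs (U, F), with U the set of remaining non-root vertices and F the set
    of remaining edges; a vertex outside U counts as the root.
    Parking functions b with b_i > 0 correspond, via b - e_i, to those of the
    deletion G - e, and the ones with b_i = 0 are those of the contraction
    G / e; spanning trees split in the same way according to whether they
    contain e, so both are equinumerous.

    Spanning of B_G: d/dx_i maps J_G onto J_(G - e), because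
    q s^(D-1) = d/dx_i (h s^D) as soon as s dh/dx_i + D h = q, and this equation
    is solvable in characteristic zero. Hence df/dx_i is, modulo d/dx_i (J_G),
    the derivative of a combination of parking monomials, and the difference
    with f no longer involves x_i: it is handled by G / e.

    Independence: for a set S of edges whose complement is connected, the
    functional f |-> (prod_(uv in S) (d/dx_u - d/dx_v) f)(0) vanishes on J_G,
    since fewer than D_I of the factors act on sum_(i in I) x_i. These
    functionals separate the combinations of parking monomials, again by
    deletion (S contains e) and contraction (S does not contain e). *)

(** * Counting through sums of indicators *)

Lemma sum_nat_of_bool_uniq (T : finType) (A P : pred T) :
    (forall x y, A x -> A y -> P x -> P y -> x = y) ->
  (\sum_(x | A x) (P x : nat))%N = [exists x, A x && P x].
Proof.
move=> AP1; case: existsP => [[x /andP[Ax Px]]|noP].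
  rewrite (bigD1 x) //= Px big1 // => y /andP[Ay /eqP yx].
  by case Py: (P y) => //; case: yx; apply: AP1.
by apply: big1 => x Ax; case Px: (P x) => //; case: noP; exists x; rewrite Ax.
Qed.

Lemma card_setI_sum (T : finType) (A : {set T}) (P : pred T) :
  #|[set x in A | P x]| = (\sum_(x in A) (P x : nat))%N.
Proof.
rewrite -sum1dep_card big_mkcondr /=.
by apply: eq_bigr => x _; case: (P x).
Qed.

(** * Deletion and contraction for parking functions and trees *)

Section DeletionContraction.
Variables (n : nat) (G : multigraph n).
Implicit Types (I U : {set 'I_n}) (F T : {set edge G}) (e : edge G).
Implicit Types (b : 'X_{1..n}).

Definition exits I (i : 'I_n) e : bool :=
  [exists j, (j \notin @vtx n @: I) && (ends e == [set vtx i; j])].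

Definition crosses I e : bool := [exists i in I, exits I i e].

(** Connectedness in terms of cuts, once the vertices outside [U] are merged with the root. *)
Definition crossed T U : bool :=
  [forall I : {set 'I_n},
     (I \subset U) && (I != set0) ==> [exists e in T, crosses I e]].

Lemma crossedP T U :
  reflect (forall I, I \subset U -> I != set0 -> exists2 e, e \in T & crosses I e)
          (crossed T U).
Proof.
apply: (iffP forallP) => [H I IU I0|H I].
  by have:= H I; rewrite IU I0 => /existsP[e /andP[]]; exists e.
by apply/implyP => /andP[IU I0]; apply/existsP; have [e eT eI] := H I IU I0;
  exists e; rewrite eT.
Qed.

Definition deg_out F I i : nat := #|[set e in F | exits I i e]|.

Definition cut F I : nat := #|[set e in F | crosses I e]|.

Lemma vtx_inj : injective (@vtx n).
Proof. exact: lift_inj. Qed.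

Lemma mem_vtx I i : (vtx i \in @vtx n @: I) = (i \in I).
Proof. by rewrite (mem_imset _ _ vtx_inj). Qed.

Lemma root_notin_vtx I : ord0 \notin @vtx n @: I.
Proof. by apply/imsetP => -[i _ /eqP]; rewrite (negPf (neq_lift _ _)). Qed.

(** An edge that leaves [I] has only one end in [I]; this turns the sum of the out-degrees into the
    size of the cut. *)
Lemma exits_uniq I i k e :
  i \in I -> k \in I -> exits I i e -> exits I k e -> i = k.
Proof.
move=> iI kI /existsP[j /andP[_ /eqP E1]] /existsP[l /andP[lI /eqP E2]].
have : vtx i \in [set vtx k; l] by rewrite -E2 E1 set21.
rewrite !inE => /orP[/eqP/vtx_inj //|/eqP il].
by rewrite -il mem_vtx iI in lI.
Qed.

Lemma sum_deg_out F I : (\sum_(i in I) deg_out F I i)%N = cut F I.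
Proof.
rewrite /deg_out /cut card_setI_sum.
under eq_bigr do rewrite card_setI_sum.
rewrite exchange_big /=; apply: eq_bigr => e _.
by apply: sum_nat_of_bool_uniq => i k; apply: exits_uniq.
Qed.

Lemma doutE I i : i \in I -> dout G I i = deg_out [set: edge G] I i.
Proof.
move=> iI; rewrite /dout /deg_out card_setI_sum.
have E j : mult G (vtx i) j
    = (\sum_(e in [set: edge G]) (ends e == [set vtx i; j] : nat))%N.
  rewrite -card_setI_sum /mult; congr #|pred_of_set _|.
  by apply/setP => e; rewrite !inE.
rewrite (eq_bigr _ (fun j _ => E j)).
rewrite exchange_big /=; apply: eq_bigr => e _.
apply: sum_nat_of_bool_uniq => j l jI lI /eqP -> /eqP E2.
have : j \in [set vtx i; l] by rewrite -E2 set22.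
rewrite !inE => /orP[/eqP ji|/eqP //].
by rewrite ji mem_vtx iI in jI.
Qed.

Lemma DoutE I : Dout G I = cut [set: edge G] I.
Proof. by rewrite -sum_deg_out; apply: eq_bigr => i; apply: doutE. Qed.

(** The parking functions of the contracted graph [(U, F)], extended by zero off [U] so that all
    pairs share one type of exponents. *)
Definition park U F b : bool :=
  [forall k, (k \notin U) ==> (b k == 0%N)] &&
  [forall I : {set 'I_n}, (I \subset U) && (I != set0) ==>
     [exists k in I, b k < deg_out F I k]].

Lemma parkP U F b :
  reflect ((forall k, k \notin U -> b k = 0%N) /\
           (forall I, I \subset U -> I != set0 ->
              exists2 k, k \in I & b k < deg_out F I k))
          (park U F b).
Proof.
apply: (iffP andP) => -[H1 H2]; split.
- by move=> k kU; apply/eqP; have/forallP/(_ k)/implyP/(_ kU) := H1.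
- move=> I IU I0; have/forallP/(_ I) := H2; rewrite IU I0 /=.
  by case/existsP => k /andP[]; exists k.
- by apply/forallP => k; apply/implyP => /H1 ->.
- apply/forallP => I; apply/implyP => /andP[IU I0].
  by have [k kI bk] := H2 I IU I0; apply/existsP; exists k; rewrite kI.
Qed.

Lemma is_parkingE b : is_parking G b = park [set: 'I_n] [set: edge G] b.
Proof.
apply/forallP/parkP => [H|[_ H] I].
  split=> [k|I _ I0]; first by rewrite inE.
  have:= H I; rewrite I0 => /existsP[k /andP[kI bk]].
  by exists k; rewrite -?doutE.
apply/implyP => I0; have [k kI bk] := H I (subsetT _) I0.
by apply/existsP; exists k; rewrite kI doutE.
Qed.

(** Here [U] is cut off from the root: all its out-degrees vanish, and the parking condition fails
    at [I = U]. *)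
Lemma park_uncrossed U F b : U != set0 ->
  (forall e, e \in F -> ~~ crosses U e) -> ~~ park U F b.
Proof.
move=> U0 noF; apply/parkP => -[_ /(_ U (subxx _) U0)[k kU]].
rewrite /deg_out (_ : [set _ in _ | _] = set0) ?cards0 //.
apply/setP => e; rewrite !inE; apply/andP => -[/noF/existsP eU ek].
by apply: eU; exists k; rewrite kU.
Qed.

Lemma park_set0 F b : park set0 F b = (b == 0%MM).
Proof.
apply/parkP/eqP => [[H _]|->].
  by apply/mnmP => k; rewrite mnm0E H ?inE.
split=> [k _|I]; first by rewrite mnm0E.
by rewrite subset0 => ->.
Qed.

(** Spanning trees of the contracted graph, described by size and cuts; [is_spanning_treeE]
    justifies this for the full graph. *)
Definition trees U F : {set {set edge G}} :=
  [set T : {set edge G} | [&& T \subset F, #|T| == #|U| & crossed T U]].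

Lemma trees_set0 F : trees set0 F = [set set0].
Proof.
apply/setP => T; rewrite !inE cards0 cards_eq0; apply/and3P/eqP.
  by case=> _ /eqP.
move->; split; rewrite ?sub0set //; apply/crossedP => I.
by rewrite subset0 => ->.
Qed.

Lemma trees_uncrossed U F : U != set0 ->
  (forall e, e \in F -> ~~ crosses U e) -> trees U F = set0.
Proof.
move=> U0 noF; apply/setP => T; rewrite !inE; apply/and3P => -[TF _].
case/crossedP/(_ U (subxx _) U0) => e /(subsetP TF)/noF eU.
by rewrite (negPf eU).
Qed.

Section Step.
Variables (U : {set 'I_n}) (F : {set edge G}) (i : 'I_n) (e : edge G).
Hypotheses (eF : e \in F) (iU : i \in U) (eU : exits U i e).

(** The other end of [e] lies outside [U], hence outside every subset of [U], so only [i] can leave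
    through [e]. *)
Lemma exits_step I k : I \subset U -> k \in I -> exits I k e = (k == i).
Proof.
move=> IU kI; have /existsP[w /andP[wU /eqP eE]] := eU.
apply/idP/eqP => [/existsP[j /andP[_ /eqP E]]|->].
  have : vtx k \in [set vtx i; w] by rewrite -eE E set21.
  rewrite !inE => /orP[/eqP/vtx_inj //|/eqP kw].
  by rewrite -kw mem_vtx (subsetP IU) in wU.
apply/existsP; exists w; rewrite eE eqxx andbT.
by apply: contra wU => /imsetP[l lI ->]; rewrite mem_vtx (subsetP IU).
Qed.

Lemma crosses_step I : I \subset U -> crosses I e = (i \in I).
Proof.
move=> IU; apply/existsP/idP => [[k /andP[kI]]|iI].
  by rewrite exits_step // => /eqP <-.
by exists i; rewrite iI exits_step ?eqxx.
Qed.

Lemma deg_out_step I k : I \subset U -> k \in I ->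
  deg_out F I k = (deg_out (F :\ e) I k + (k == i))%N.
Proof.
move=> IU kI; rewrite /deg_out (cardsD1 e) inE eF exits_step //= addnC.
by congr (#|pred_of_set _| + _)%N; apply/setP => f; rewrite !inE andbA.
Qed.

Lemma cut_step I : I \subset U -> cut F I = (cut (F :\ e) I + (i \in I))%N.
Proof.
move=> IU; rewrite /cut (cardsD1 e) inE eF crosses_step //= addnC.
by congr (#|pred_of_set _| + _)%N; apply/setP => f; rewrite !inE andbA.
Qed.

(** Passing from left to right, both sides of each inequality drop by one at [k = i] and are
    unchanged at the other vertices. *)
Lemma park_delete b : park U F (b + U_(i))%MM = park U (F :\ e) b.
Proof.
apply/parkP/parkP => -[H1 H2]; split.
- move=> k kU; have:= H1 k kU; rewrite mnmDE mnm1E.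
  by case: eqP => [ik|_]; rewrite ?addn0 // -ik iU in kU *.
- move=> I IU I0; have [k kI] := H2 I IU I0.
  by rewrite mnmDE mnm1E deg_out_step // [i == k]eq_sym ltn_add2r; exists k.
- move=> k kU; rewrite mnmDE mnm1E H1 //.
  by case: eqP => // ik; rewrite -ik iU in kU.
- move=> I IU I0; have [k kI bk] := H2 I IU I0; exists k => //.
  by rewrite mnmDE mnm1E deg_out_step // [i == k]eq_sym ltn_add2r.
Qed.

(** A set containing [i] gives no constraint: [i] itself is a witness, because [b i = 0] and [e]
    leaves the set from [i]. The other subsets of [U] do not see [e]. *)
Lemma park_contract b : b i = 0%N -> park U F b = park (U :\ i) (F :\ e) b.
Proof.
move=> bi; apply/parkP/parkP => -[H1 H2]; split.
- move=> k; rewrite !inE negb_and negbK => /orP[/eqP ->//|]; exact: H1.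
- move=> I; rewrite subsetD1 => /andP[IU iI] I0.
  have [k kI] := H2 I IU I0; rewrite deg_out_step //.
  case: eqP => [ki|_]; first by rewrite -ki kI in iI.
  by rewrite addn0; exists k.
- by move=> k kU; apply: H1; rewrite !inE negb_and kU orbT.
- move=> I IU I0; have [iI|iI] := boolP (i \in I).
    by exists i; rewrite // bi deg_out_step // eqxx addn1.
  have [|k kI bk] := H2 I _ I0; first by rewrite subsetD1 IU.
  by exists k; rewrite // deg_out_step // ltn_addr.
Qed.

Lemma crossed_step T : e \notin T ->
  crossed (e |: T) U = crossed T (U :\ i).
Proof.
move=> eT; apply/crossedP/crossedP => H I.
  rewrite subsetD1 => /andP[IU iI] I0; have [f] := H I IU I0.
  rewrite !inE => /orP[/eqP ->|fT fI]; last by exists f.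
  by rewrite crosses_step // (negPf iI).
move=> IU I0; have [iI|iI] := boolP (i \in I).
  by exists e; rewrite ?setU11 ?crosses_step.
have [|f fT fI] := H I _ I0; first by rewrite subsetD1 IU.
by exists f; rewrite // setU1r.
Qed.

Lemma card_trees_step :
  #|trees U F| = (#|trees U (F :\ e)| + #|trees (U :\ i) (F :\ e)|)%N.
Proof.
rewrite -(cardsID [set T : {set edge G} | e \in T]) addnC; congr addn.
  apply: eq_card => T; rewrite !inE subsetD1.
  by rewrite andbC -!andbA; do !bool_congr.
rewrite -(card_in_imset (f := fun T : {set edge G} => e |: T) (D := trees _ _)); last first.
  move=> T1 T2; rewrite !inE !subsetD1 -!andbA => /and3P[_ e1 _] /and3P[_ e2 _].
  by move/(congr1 (fun T : {set edge G} => T :\ e)); rewrite !setU1K.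
apply: eq_card => T; apply/idP/imsetP => [|[S]].
  rewrite !inE; case/andP=> /and3P[TF TU TX] eT; exists (T :\ e); last by rewrite setD1K.
  rewrite !inE setSD //= -crossed_step ?setD1K ?setD11 // TX andbT.
  by move: TU; rewrite (cardsD1 e) eT (cardsD1 i U) iU eqSS.
rewrite !inE subsetD1; case/and3P=> /andP[SF eS] SU SX ->; rewrite setU11 subUset sub1set eF SF.
by rewrite cardsU1 eS (cardsD1 i U) iU eqSS SU crossed_step // SX.
Qed.

End Step.

(** Deletion and contraction both remove an edge, so the induction is on the size of [F], for all
    [U] at once. It stops when everything is contracted into the root or no edge leaves [U]. *)
Lemma deletion_contraction_ind (Q : {set 'I_n} -> {set edge G} -> Prop) :
    (forall F, Q set0 F) ->
    (forall U F, U != set0 -> (forall e, e \in F -> ~~ crosses U e) -> Q U F) ->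
    (forall U F i e, e \in F -> i \in U -> exits U i e ->
       Q U (F :\ e) -> Q (U :\ i) (F :\ e) -> Q U F) ->
  forall U F, Q U F.
Proof.
move=> Q0 Qunc Qstep U F.
elim: {F}_.+1 {-2}F (ltnSn #|F|) U => // m IHm F leFm U.
have [->|U0] := eqVneq U set0; first exact: Q0.
have [/existsP[e /andP[eF /existsP[i /andP[iU eU]]]]|noF] :=
    boolP [exists e in F, crosses U e].
  have ltFe : #|F :\ e| < m by rewrite (cardsD1 e) eF in leFm.
  by apply: (Qstep U F i e) => //; apply: IHm.
apply: Qunc => // e eF; apply: contra noF => eU.
by apply/existsP; exists e; rewrite eF.
Qed.

(** Besides the count, the list provides the finiteness of the set of parking functions, which the
    type of exponents does not give. *)
Lemma park_enum U F : exists s : seq 'X_{1..n},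
  [/\ uniq s, s =i park U F & size s = #|trees U F|].
Proof.
move: U F; apply: deletion_contraction_ind => [F|U F U0 noF|U F i e eF iU eU].
- exists [:: 0%MM]; split; rewrite ?trees_set0 ?cards1 // => b.
  by rewrite inE -[RHS]/(park _ _ _) park_set0.
- exists [::]; split; rewrite ?trees_uncrossed ?cards0 // => b.
  by rewrite -[RHS]/(park _ _ _) (negPf (park_uncrossed _ _ _)).
case=> s1 [us1 s1P sz1] [s2 [us2 s2P sz2]].
(* The shifted list holds the functions positive at [i], the second list those vanishing at [i], so
   the two are disjoint. *)
exists ([seq (b + U_(i))%MM | b <- s1] ++ s2); split.
- rewrite cat_uniq us2 map_inj_uniq ?us1 /=; last first.
    by move=> b1 b2 /mnmP E; apply/mnmP => k; have:= E k; rewrite !mnmDE => /addIn.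
  rewrite andbT; apply/hasPn => b; rewrite s2P => /parkP[H _].
  apply/mapP => -[c _ E]; have:= H i; rewrite !inE eqxx => /(_ isT).
  by rewrite E mnmDE mnm1E eqxx addn1.
- move=> b; rewrite mem_cat s2P -!topredE /=.
  have [bi|bi] := eqVneq (b i) 0%N.
    rewrite (park_contract eF eU bi) orbC; case: park => //=.
    apply/mapP => -[c _ E]; move: bi.
    by rewrite E mnmDE mnm1E eqxx addn1.
  have E : b = (b - U_(i) + U_(i))%MM by rewrite submK // lep1mP.
  rewrite [park (U :\ i) _ _](_ : _ = false); last first.
    by apply/parkP => -[/(_ i)]; rewrite !inE eqxx => /(_ isT)/eqP; rewrite (negPf bi).
  rewrite orbF [in RHS]E (park_delete eF iU eU); apply/mapP/idP => [[c cs ->]|H].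
    by rewrite addmK -[park _ _ _]s1P.
  by exists (b - U_(i))%MM; rewrite // s1P.
- by rewrite size_cat size_map sz1 sz2 (card_trees_step eF iU eU).
Qed.

End DeletionContraction.

(** * Spanning trees as minimal connected sets of edges *)

Section SpanningTrees.
Variables (n : nat) (G : multigraph n).
Implicit Types (I U : {set 'I_n}) (T : {set edge G}) (e : edge G).

(** A form symmetric in the two ends, whereas [crosses] singles out the end inside [I]. *)
Lemma crossesE I e u v : ends e = [set u; v] ->
  crosses I e = ((u \in @vtx n @: I) != (v \in @vtx n @: I)).
Proof.
move=> euv; apply/idP/idP => [/existsP[i /andP[iI]]|].
  case/existsP=> j /andP[jI /eqP eij].
  have : vtx i \in [set u; v] by rewrite -euv eij set21.
  have : j \in [set u; v] by rewrite -euv eij set22.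
  rewrite !inE => /orP[]/eqP E1 /orP[]/eqP E2.
  - by rewrite -E2 in E1; rewrite E1 mem_vtx iI in jI.
  - by rewrite -E1 -E2 mem_vtx iI (negPf jI).
  - by rewrite -E1 -E2 mem_vtx iI (negPf jI).
  - by rewrite -E2 in E1; rewrite E1 mem_vtx iI in jI.
wlog uI : u v euv / u \in @vtx n @: I.
  move=> H; have [uI|uI] := boolP (u \in @vtx n @: I).
    by have:= H u v euv uI; rewrite uI.
  have [vI _|vI] := boolP (v \in @vtx n @: I); last by [].
  by apply: (H v u) => //; rewrite ?(negPf uI) ?vI // setUC.
rewrite uI eq_sym eqb_id; have /imsetP[i iI ui] := uI => vI.
apply/existsP; exists i; rewrite iI; apply/existsP; exists v.
by rewrite -ui euv vI eqxx.
Qed.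

Lemma adj_sym T : ssrbool.symmetric (@adj n G T).
Proof. by move=> u v; rewrite /adj; under eq_existsb do rewrite setUC. Qed.

(** A set of non-root vertices crossed by no edge of [T] is closed under adjacency, so no path joins
    it to the root. *)
Lemma connected_sub_crossed T : connected_sub T = crossed T [set: 'I_n].
Proof.
apply/idP/crossedP => [cT I _ /set0Pn[i iI]|H].
  have [/exists_inP[e]|noT] := boolP [exists e in T, crosses I e]; first by exists e.
  have clI : closed (adj T) (@vtx n @: I).
    move=> u v /exists_inP[e eT /eqP euv]; apply/eqP; rewrite -[_ == _]negbK.
    rewrite -(crossesE _ euv); apply: contra noT => eI.
    by apply/exists_inP; exists e.
  have/forallP/(_ (vtx i))/forallP/(_ ord0)/(closed_connect clI) := cT.
  by rewrite mem_vtx iI (negPf (root_notin_vtx _)).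
suff conn0 u : connect (adj T) ord0 u.
  apply/forallP => u; apply/forallP => v; apply: connect_trans (conn0 v).
  by rewrite (sym_connect_sym (adj_sym T)).
(* Conversely, no edge of [T] can cross the set of vertices out of reach of the root, which is
   therefore empty. *)
pose I := [set i : 'I_n | ~~ connect (adj T) ord0 (vtx i)].
have [I0|/(H I (subsetT _))[e eT /existsP[i /andP[]]]] := eqVneq I set0.
  have [i ->|->] := unliftP ord0 u; last exact: connect0.
  by apply: contraFT (in_set0 i) => ci; rewrite -I0 inE.
rewrite inE => /negP ci /existsP[j /andP[jI /eqP eij]]; case: ci.
apply: (connect_trans (y := j)).
  have [k jk|->] := unliftP ord0 j; last exact: connect0.
  by move: jI; rewrite jk mem_vtx inE negbK.
by apply: connect1; apply/exists_inP; exists e; rewrite // eij setUC.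
Qed.

(** The tree grows from the root: pick an edge that leaves [U], contract its end [i] into the root,
    and repeat with [U :\ i]. *)
Lemma crossed_subtree U T : crossed T U ->
  exists T0 : {set edge G}, [/\ T0 \subset T, crossed T0 U & #|T0| = #|U|].
Proof.
elim: {U}_.+1 {-2}U (ltnSn #|U|) T => // m IHm U leUm T TU.
have [U0|U0] := eqVneq U set0.
  exists set0; rewrite U0 !cards0 sub0set; split=> //.
  by apply/crossedP => I; rewrite subset0 => ->.
have [e eT /existsP[i /andP[iU eU]]] := crossedP _ _ TU U (subxx _) U0.
move: TU; rewrite -(setD1K eT) (crossed_step eU) ?setD11 //.
rewrite (cardsD1 i) iU in leUm; case/(IHm _ leUm) => T0 [T0T T0U cT0].
have eT0 : e \notin T0 by apply: contraTN T0T => eT0; rewrite subsetD1 eT0 andbF.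
exists (e |: T0); rewrite setUS // (crossed_step eU) // cardsU1 eT0 cT0.
by rewrite (cardsD1 i U) iU.
Qed.

Lemma leq_card_crossed U T : crossed T U -> #|U| <= #|T|.
Proof.
by case/crossed_subtree => T0 [T0T _ <-]; apply: subset_leq_card.
Qed.

(* The two ends of the removed edge stay on the same side of any cut that
   misses the remaining edges of the cycle. *)
Lemma cycle_edge_removable T U : crossed T U -> has_cycle T ->
  exists2 e, e \in T & crossed (T :\ e) U.
Proof.
move=> TU /existsP[k /existsP[v /existsP[c /and4P[_ /injectiveP inj_c]]]].
move=> /forallP cT /forallP cv.
exists (c ord_max); first exact: cT.
apply/crossedP => I IU I0; have [e eT eI] := crossedP _ _ TU I IU I0.
have [ek|] := eqVneq e (c ord_max); last by exists e; rewrite // !inE; apply/andP.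
have [/exists_inP[f fT fI]|noI] := boolP [exists f in T :\ c ord_max, crosses I f].
  by exists f.
have same i (ltik : i.+1 < k.+1) :
    (v (Ordinal (ltnW ltik)) \in @vtx n @: I) = (v (Ordinal ltik) \in @vtx n @: I).
  apply/eqP; rewrite -[_ == _]negbK.
  have /eqP := cv (Ordinal (ltnW ltik)).
  have -> : ordS (Ordinal (ltnW ltik)) = Ordinal ltik.
    by apply: val_inj; rewrite /= modn_small.
  move/crossesE => <-; apply: contra noI => cI; apply/exists_inP.
  exists (c (Ordinal (ltnW ltik))); rewrite // !inE cT andbT.
  by apply/eqP => /inj_c/(congr1 val)/eqP; rewrite /= ltn_eqF.
have all_same i (ltik : i < k.+1) :
    (v ord0 \in @vtx n @: I) = (v (Ordinal ltik) \in @vtx n @: I).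
  elim: i ltik => [|i IHi] ltik; last by rewrite -same -IHi.
  by rewrite (_ : Ordinal ltik = ord0) //; apply: val_inj.
have := eI; rewrite ek (crossesE _ (eqP (cv ord_max))).
have -> : ordS ord_max = ord0 :> 'I_k.+1 by apply: val_inj; rewrite /= modnn.
by rewrite (all_same _ (ltnSn k)) (_ : Ordinal _ = ord_max) ?eqxx //; apply: val_inj.
Qed.

Lemma cycle_of_extra_edge T e : crossed T [set: 'I_n] -> e \notin T ->
  has_cycle (e |: T).
Proof.
rewrite -connected_sub_crossed => /forallP cT eT.
have [u [v euv]] : exists u v, ends e = [set u; v].
  have /andP[e0 e2] := card_ends e; have [u ue] := card_gt0P e0.
  move: e2; rewrite (cardsD1 u) ue ltnS leq_eqVlt => /orP[/cards1P[v ev]|].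
    by exists u, v; rewrite -(setD1K ue) ev.
  rewrite ltnS leqn0 cards_eq0 => /eqP eu.
  by exists u, u; rewrite setUid -(setD1K ue) eu setU0.
have /connectP[p0 p0T vE] := forallP (cT u) v; rewrite {v}vE in euv.
(* The vertices of the path become distinct. If [e] is a loop, the path is then empty and the cycle
   has length 1. *)
case/shortenP: p0T euv => p pT p_uniq _ euv {p0}.
have pn : size p < n.+1.
  have := max_card (mem (u :: p)); rewrite card_ord.
  by move/card_uniqP: p_uniq => ->.
pose w i := nth u (u :: p) i.
have wT i : i < size p -> exists2 f, f \in T & ends f == [set w i; w i.+1].
  by move=> ip; have/pathP/(_ i ip)/exists_inP := pT => /(_ u).
(* The cycle follows the path through edges of [T]; its last edge, at index [size p], is [e]. *)
have [c cP] : exists c : {ffun 'I_(size p).+1 -> edge G},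
    forall i : 'I_(size p).+1,
    if i < size p then (c i \in T) && (ends (c i) == [set w i; w i.+1])
    else c i == e.
  have ex (i : 'I_(size p).+1) : exists f,
      if i < size p then (f \in T) && (ends f == [set w i; w i.+1]) else f == e.
    by case: ltnP => [/wT[f fT fe]|_]; [exists f; rewrite fT|exists e].
  by exists [ffun i => xchoose (ex i)] => i; rewrite ffunE; exact: (xchooseP (ex i)).
have w_inj i j : i < (size p).+1 -> j < (size p).+1 -> w i = w j -> i = j.
  by move=> ip jp /eqP; rewrite nth_uniq // => /eqP.
apply/existsP; exists (Ordinal pn); apply/existsP.
exists [ffun i : 'I_(size p).+1 => w i]; apply/existsP; exists c.
apply/and4P; split.
- by apply/injectiveP => i j; rewrite !ffunE => /w_inj-/(_ (ltn_ord _) (ltn_ord _))/val_inj.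
(* Equal path edges have the same pair of ends; since [w] is injective, the only alternative to
   [i = j] is [i = j + 1] with [i + 1] equal to [j] or [j + 1], which is absurd. The edge [e]
   differs from the path edges because it is not in [T]. *)
- apply/injectiveP => i j cij; apply: val_inj => /=.
  have := cP i; have := cP j; rewrite -cij.
  case: ltnP => jp; case: ltnP => ip.
  + case/andP=> _ /eqP-> /andP[_ /eqP E].
    have : w i \in [set w j; w j.+1] by rewrite E set21.
    rewrite !inE => /orP[/eqP/w_inj-> //|/eqP/w_inj].
    rewrite !ltnS => /(_ (ltnW ip) jp) ij.
    have : w i.+1 \in [set w j; w j.+1] by rewrite E set22.
    rewrite !inE ij => /orP[]/eqP/w_inj; rewrite !ltnS.
      by rewrite -ij ip (ltnW jp) ij => /(_ isT isT)/eqP; rewrite gtn_eqF.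
    by rewrite -ij ip (ltnW ip) ij => /(_ isT isT)/eqP; rewrite gtn_eqF.
  + by case/andP=> eT' _ /eqP ei; rewrite -ei eT' in eT.
  + by move=> /eqP ei /andP[]; rewrite ei (negPf eT).
  + move=> _ _; apply/eqP; rewrite eqn_leq.
    by rewrite (leq_trans _ jp) ?(leq_trans _ ip) // -ltnS.
- apply/forallP => i; have := cP i; rewrite !inE.
  by case: ltnP => _ => [/andP[-> _]|->]; rewrite ?orbT.
- apply/forallP => i; have := cP i; rewrite !ffunE /=.
  case: ltnP => [ip /andP[_ /eqP->]|ip /eqP->].
    by rewrite modn_small.
  have -> : i = size p :> nat by apply/eqP; rewrite eqn_leq ip -ltnS ltn_ord.
  by rewrite modnn euv setUC /w /= (last_nth u).
Qed.

(** If [T] is acyclic, an edge of [T] outside a tree [T0] contained in [T] would close a cycle. If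
    [T] has [n] edges, a cycle would allow removing one of them, leaving too few edges to cross
    every set. *)
Lemma is_spanning_treeE T :
  is_spanning_tree T = (#|T| == n) && crossed T [set: 'I_n].
Proof.
rewrite /is_spanning_tree connected_sub_crossed andbC.
have [TX|] := boolP (crossed T _); last by rewrite !andbF.
rewrite !andbT; have := leq_card_crossed TX; rewrite cardsT card_ord => leT.
apply/idP/eqP => [acT|cT].
  have [T0 [T0T T0X cT0]] := crossed_subtree TX.
  rewrite cardsT card_ord in cT0.
  have [<-//|neT] := eqVneq T0 T.
  have /properP[_ [e eT eT0]] : T0 \proper T by rewrite properEneq neT.
  case/negP: acT; have := cycle_of_extra_edge T0X eT0.
  case/existsP=> k /existsP[v /existsP[c /and4P[vi ci /forallP cT cv]]].
  apply/existsP; exists k; apply/existsP; exists v; apply/existsP; exists c.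
  rewrite vi ci cv andbT; apply/forallP => i; have := cT i.
  by rewrite !inE => /orP[/eqP->//|/(subsetP T0T)].
apply/negP => /(cycle_edge_removable TX)[e eT /leq_card_crossed].
by move: cT; rewrite cardsT card_ord (cardsD1 e) eT => {1}<-; rewrite ltnn.
Qed.

Lemma num_spanning_treesE :
  num_spanning_trees G = #|trees [set: 'I_n] [set: edge G]|.
Proof.
apply: eq_card => T.
by rewrite !inE is_spanning_treeE subsetT cardsT card_ord.
Qed.

End SpanningTrees.

Local Open Scope ring_scope.

(** * Quotients with a basis of monomials *)

Section MonomialBasis.
Variables (K : fieldType) (n : nat) (I : finType) (P : pred I).
Variable g : I -> {mpoly K[n]}.
Local Notation pi := (quot_pi P g).
Local Notation ideal := (gen_ideal P g).

(** Independence and spanning are reduced to conditions on supports, so that a combination of the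
    monomials is handled as a single polynomial. *)
Lemma monomial_basis_on (W : quot_alg P g -> Prop) (T : eqType)
    (phi : T -> 'X_{1..n}) :
    injective phi -> (forall t, W (pi 'X_[phi t])) ->
    (forall f, f \in ideal ->
       (forall m, m \in msupp f -> exists t, phi t = m) -> f = 0) ->
    (forall v, W v ->
       exists2 f, v = pi f & forall m, m \in msupp f -> exists t, phi t = m) ->
  basis_on W (fun t => pi 'X_[phi t]).
Proof.
move=> phi_inj Wphi indep span; split=> // [s c s_uniq sum0 t ts|v /span[f -> fT]].
  have coefE u : u \in s -> (\sum_(t <- s) c t *: 'X_[phi t])@_(phi u) = c u.
    move=> us; rewrite raddf_sum /= (bigD1_seq u) //= mcoeffZ mcoeffX eqxx mulr1.
    rewrite big1 ?addr0 // => t' /negPf tu.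
    by rewrite mcoeffZ mcoeffX (inj_eq phi_inj) tu mulr0.
  rewrite -(coefE t ts) (indep (\sum_(t <- s) c t *: 'X_[phi t])) ?mcoeff0 //.
    rewrite -[X in X \in _]subr0 -quot_pi_eq raddf0 raddf_sum /=.
    by under eq_bigr do rewrite linearZ /=; rewrite sum0.
  move=> m /msupp_sum_le/flattenP[_ /mapP[u _ ->]] /msuppZ_le/mem_msuppXP <-.
  by exists u.
have [s sE] : exists s, map phi s = msupp f.
  elim: (msupp f) fT => [|m l IHl] lT; first by exists [::].
  have [|s <-] := IHl; first by move=> m' m'l; apply: lT; rewrite inE m'l orbT.
  by have [t <-] := lT m (mem_head _ _); exists (t :: s).
exists s, (fun t => f@_(phi t)); rewrite {1}(mpolyE f) -sE big_map raddf_sum /=.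
by under eq_bigr do rewrite linearZ /=.
Qed.

Lemma has_dim_monomials (W : quot_alg P g -> Prop) (s : seq 'X_{1..n}) :
    uniq s -> (forall m, m \in s -> W (pi 'X_[m])) ->
    (forall f, f \in ideal -> {subset msupp f <= s} -> f = 0) ->
    (forall v, W v -> exists2 f, v = pi f & {subset msupp f <= s}) ->
  has_dim W (size s).
Proof.
move=> s_uniq Ws indep span.
have nthP m : m \in s -> exists t : 'I_(size s), nth 0%MM s t = m.
  by move=> ms; exists (Ordinal (etrans (index_mem m s) ms)); rewrite /= nth_index.
exists (fun t : 'I_(size s) => pi 'X_[nth 0%MM s t]).
apply: (monomial_basis_on (phi := fun t : 'I_(size s) => nth 0%MM s t)).
- move=> t u /= tu; apply/val_inj/eqP => /=.
  by rewrite -(nth_uniq 0%MM _ _ s_uniq) // tu.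
- by move=> t; apply: Ws; rewrite mem_nth.
- by move=> f fI fs; apply: indep => // m /fs[t mt]; rewrite -mt mem_nth.
- by move=> v /span[f -> fs]; exists f => // m /fs/nthP.
Qed.

Lemma msupp_pihomog k (p : {mpoly K[n]}) : {subset msupp (pihomog mdeg k p) <= msupp p}.
Proof.
move=> m; rewrite pihomogE => /msupp_sum_le/flattenP[l /mapP[u]].
by rewrite mem_filter => /andP[_ up] -> /msuppZ_le/mem_msuppXP <-.
Qed.

Lemma gen_ideal_sum (J : Type) (r : seq J) (Q : pred J) (F : J -> {mpoly K[n]}) :
  (forall j, Q j -> F j \in ideal) -> \sum_(j <- r | Q j) F j \in ideal.
Proof. by move=> FI; apply: rpred_sum. Qed.

Lemma gen_ideal_gen i a : P i -> a * g i \in ideal.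
Proof.
move=> Pi; apply/gen_idealM/gen_idealP; exists (fun j => (j == i)%:R).
rewrite (bigD1 i) //= eqxx mul1r big1 ?addr0 // => j /andP[_ /negPf ->].
by rewrite mul0r.
Qed.

(** With coefficients expanded into monomials, each term is a homogeneous multiple of a generator,
    which the projection either keeps or kills. *)
Lemma gen_ideal_pihomog (d : I -> nat) k f :
    (forall i, P i -> g i \is (d i).-homog) ->
  f \in ideal -> pihomog mdeg k f \in ideal.
Proof.
move=> g_homog /gen_idealP[c ->]; rewrite linear_sum gen_ideal_sum // => i Pi.
rewrite [c i]mpolyE mulr_suml linear_sum gen_ideal_sum // => m _.
rewrite -scalerAl linearZ /= -mulr_algl gen_idealM //.
have Xg : 'X_[m] * g i \is (mdeg m + d i).-homog.
  by rewrite dhomogM ?g_homog // dhomogX.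
have [kE|kE] := eqVneq (mdeg m + d i)%N k.
  by rewrite pihomog_dE -?kE // gen_ideal_gen.
by rewrite (pihomog_ne0 kE Xg) rpred0.
Qed.

Variable s : seq 'X_{1..n}.
Hypothesis s_uniq : uniq s.
Hypothesis s_indep : forall f, f \in ideal -> {subset msupp f <= s} -> f = 0.
Hypothesis s_span : forall f, exists2 p, f - p \in ideal & {subset msupp p <= s}.

Lemma has_dim_quot : has_dim (whole (quot_alg P g)) (size s).
Proof.
apply: has_dim_monomials => // v _; have [f ->] := quot_pi_surj v.
by have [p fp ps] := s_span f; exists p => //; apply/eqP; rewrite quot_pi_eq.
Qed.

(** The series depends on [s] only, so two ideals with the same [s] have the same Hilbert series. *)
Lemma hilbert_series_quot (d : I -> nat) :
    (forall i, P i -> g i \is (d i).-homog) ->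
  hilbert_series P g (fun k => size [seq m <- s | mdeg m == k]).
Proof.
move=> g_homog k; apply: has_dim_monomials.
- exact: filter_uniq.
- by move=> m; rewrite mem_filter => /andP[mk _]; exists 'X_[m]; rewrite ?dhomogX.
- by move=> f fI fs; apply: s_indep => // m /fs; rewrite mem_filter => /andP[].
move=> _ [f fk ->]; have [p fp ps] := s_span f.
(* The representative [p] need not be homogeneous; its part of degree [k] represents the same class,
   because the ideal is homogeneous. *)
exists (pihomog mdeg k p) => [|m mp].
  apply/eqP; rewrite quot_pi_eq -(pihomog_dE fk) -pihomogB.
  exact: (gen_ideal_pihomog k g_homog fp).
rewrite mem_filter (ps _ (msupp_pihomog mp)) andbT.
by apply/eqP; apply: (dhomog_mf (pihomogP _ k p)).
Qed.

End MonomialBasis.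

(** * The monomial ideal and its standard monomials *)

Section MonomialIdeal.
Variables (n : nat) (G : multigraph n) (K : fieldType).

Definition cut_mnm (I : {set 'I_n}) : 'X_{1..n} :=
  [multinom (if i \in I then dout G I i else 0%N) | i < n].

Lemma mIE I : mI G K I = 'X_[cut_mnm I].
Proof.
rewrite /mI mpolyXE_id big_mkcond /=; apply: eq_bigr => i _.
by rewrite mnmE; case: ifP => // _; rewrite expr0.
Qed.

(** The parking condition fails at [I] exactly when [m_I] divides [x^b]; parking monomials are thus
    the standard monomials of the ideal. *)
Lemma is_parkingPn b :
  reflect (exists2 I, nonempty I & (cut_mnm I <= b)%MM) (~~ is_parking G b).
Proof.
apply: (iffP idP) => [|[I I0 /mnm_lepP Ib]].
  rewrite negb_forall => /existsP[I]; rewrite negb_imply => /andP[I0 noI].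
  exists I => //; apply/mnm_lepP => i; rewrite mnmE; case: ifP => // iI.
  by rewrite leqNgt; apply: contra noI => bi; apply/exists_inP; exists i.
rewrite negb_forall; apply/existsP; exists I; rewrite negb_imply [X in X && _]I0.
apply/exists_inP => -[i iI]; have := Ib i.
by rewrite mnmE iI leqNgt => /negPf ->.
Qed.

Lemma mI_homog I : mI G K I \is (mdeg (cut_mnm I)).-homog.
Proof. by rewrite mIE dhomogX. Qed.

Lemma mI_indep f : f \in gen_ideal (@nonempty n) (mI G K) ->
  {subset msupp f <= is_parking G} -> f = 0.
Proof.
case/gen_idealP=> c fE fpark; apply/mpolyP => m; rewrite mcoeff0.
have [mf|] := boolP (m \in msupp f); last exact: memN_msupp_eq0.
rewrite fE raddf_sum big1 //= => I I0; rewrite mIE; apply: memN_msupp_eq0.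
rewrite (perm_mem (msuppMX _ _)); apply/mapP => -[k _ mE].
have : ~~ is_parking G m by apply/is_parkingPn; exists I; rewrite // mE lem_addr.
by move/negP; apply; exact: fpark.
Qed.

Lemma mI_span f : exists2 p, f - p \in gen_ideal (@nonempty n) (mI G K) &
  {subset msupp p <= is_parking G}.
Proof.
exists (\sum_(m <- msupp f | is_parking G m) f@_m *: 'X_[m]); last first.
  move=> m /msupp_sum_le/flattenP[l /mapP[u]].
  by rewrite mem_filter => /andP[up _] -> /msuppZ_le/mem_msuppXP <-.
rewrite {1}[f]mpolyE (bigID (is_parking G)) /= addrAC subrr add0r.
apply: gen_ideal_sum => m /is_parkingPn[I I0 Im].
rewrite -(submK Im) mpolyXD -mIE scalerAl.
exact: gen_ideal_gen.
Qed.

End MonomialIdeal.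

(** * Differentiation and integration in characteristic zero *)

Section PolynomialCalculus.
Variables (K : fieldType) (n : nat).
Hypothesis char0 : forall k, k.+1%:R != 0 :> K.
Implicit Types (f q h s : {mpoly K[n]}) (i j : 'I_n) (m : 'X_{1..n}).

(** The exponent that differentiation brings down is invertible when positive, so no term involving
    [x_j] is lost. *)
Lemma mderiv_eq0P f j :
  f^`M(j) = 0 <-> (forall m, m \in msupp f -> m j = 0%N).
Proof.
split=> [f0 m mf|H].
  apply: contraTeq mf => mj; rewrite mcoeff_msupp negbK.
  have := congr1 (mcoeff (m - U_(j))) f0.
  rewrite mcoeff_deriv submK ?lep1mP // mcoeff0 -mulr_natr => /eqP.
  by rewrite mulf_eq0 (negPf (char0 _)) orbF.
apply/mpolyP => m; rewrite mcoeff_deriv mcoeff0.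
rewrite (memN_msupp_eq0 (m := (m + U_(j))%MM)) ?mul0rn //.
by apply/negP => /H; rewrite mnmDE mnm1E eqxx addn1.
Qed.

Definition primitive i q : {mpoly K[n]} :=
  \sum_(m <- msupp q) (q@_m / (m i).+1%:R) *: 'X_[(m + U_(i))].

Lemma mderiv_primitive i q : (primitive i q)^`M(i) = q.
Proof.
rewrite [RHS]mpolyE raddf_sum /=; apply: eq_bigr => m _.
rewrite mderivZ mderivX mnmDE mnm1E eqxx addn1 addmK scalerA divfK //.
Qed.

Lemma mderiv_primitive_eq0 i j q :
  i != j -> q^`M(j) = 0 -> (primitive i q)^`M(j) = 0.
Proof.
move=> ij /mderiv_eq0P q0; rewrite raddf_sum big1_seq //= => m /q0 mj.
by rewrite mderivZ mderivX mnmDE mnm1E mj (negPf ij) scale0r scaler0.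
Qed.

Lemma msupp_primitive i q m :
  m \in msupp (primitive i q) -> exists2 m', m' \in msupp q & m = (m' + U_(i))%MM.
Proof.
move=> /msupp_sum_le/flattenP[l /mapP[m']]; rewrite filter_predT => m'q -> {l}.
by move/msuppZ_le/mem_msuppXP => <-; exists m'.
Qed.

Lemma msize_mderiv_le i q N : (msize q <= N.+1)%N -> (msize q^`M(i) <= N)%N.
Proof.
move=> qN; rewrite msizeE; apply/bigmax_leqP_seq => m mq _.
rewrite -ltnS (leq_trans _ qN) //.
have -> : (mdeg m).+2 = (mdeg (m + U_(i))%MM).+1 by rewrite mdegD mdeg1 addn1.
apply: msize_mdeg_lt; apply: contraTT mq => mq; rewrite mcoeff_msupp negbK.
by rewrite mcoeff_deriv (memN_msupp_eq0 mq) mul0rn.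
Qed.

(* The operator s d/dx_i + D is an Euler operator in the coordinates where s
   replaces x_i: if h' solves the equation for q' and D + 1, then
   (q - s h') / D solves it for q and D. *)
Lemma euler_solve i s q (D : nat) : s^`M(i) = 1 ->
  exists2 h, s * h^`M(i) + h *+ D.+1 = q &
    forall j, s^`M(j) = 0 -> q^`M(j) = 0 -> h^`M(j) = 0.
Proof.
move=> si; elim: (msize q) {-2}q (leqnn (msize q)) D => {q} [|N IHN] q leq_q D.
  move: leq_q; rewrite leqn0 msize_poly_eq0 => /eqP ->; exists 0 => [|j _ _].
    by rewrite mderiv0 mulr0 mul0rn addr0.
  exact: mderiv0.
have [h hE h0] := IHN _ (msize_mderiv_le i leq_q) D.+1.
exists (D.+1%:R^-1 *: (q - s * h)) => [|j sj qj].
  have divK (r : {mpoly K[n]}) : (D.+1%:R^-1 *: r) *+ D.+1 = r.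
    by rewrite -scaler_nat scalerA mulfV ?scale1r.
  have -> : (D.+1%:R^-1 *: (q - s * h))^`M(i) = h.
    rewrite mderivZ mderivB mderivM si mul1r -hE [h *+ _]mulrSr.
    rewrite [h + _]addrC opprD addrACA subrr add0r addrK.
    by rewrite -[h *+ _]scaler_nat scalerA mulVf ?scale1r.
  by rewrite divK addrC subrK.
by rewrite mderivZ mderivB mderivM sj qj h0 ?mul0r ?mulr0 ?addr0 ?subr0 ?scaler0 //
  mderiv_comm qj mderiv0.
Qed.

End PolynomialCalculus.

(** * The power ideal: spanning by parking monomials *)

Section PowerIdeal.
Variables (n : nat) (G : multigraph n) (K : fieldType).
Implicit Types (I U : {set 'I_n}) (F : {set edge G}) (e : edge G).
Implicit Types (f h : {mpoly K[n]}).

Definition linear_form I : {mpoly K[n]} := \sum_(i in I) 'X_i.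

Lemma pIE I : pI G K I = linear_form I ^+ cut [set: edge G] I.
Proof. by rewrite /pI DoutE. Qed.

Lemma linear_form_homog I : linear_form I \is 1.-homog.
Proof. by apply: rpred_sum => i _; rewrite dhomogX; apply/eqP; exact: mdeg1. Qed.

Lemma pI_homog I : pI G K I \is (Dout G I).-homog.
Proof. by have := dhomogMn (Dout G I) (linear_form_homog I); rewrite mul1n. Qed.

Lemma mderiv_linear_form I j : (linear_form I)^`M(j) = (j \in I)%:R.
Proof.
have dX i : ('X_i : {mpoly K[n]})^`M(j) = (i == j)%:R.
  rewrite mderivX mnm1E; case: eqP => [->|_]; last by rewrite scale0r.
  by rewrite scale1r -{1}[U_(j)%MM]add0m addmK mpolyX0.
rewrite raddf_sum /=; under eq_bigr do rewrite dX.
have [jI|jI] := boolP (j \in I).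
  by rewrite (bigD1 j) //= eqxx big1 ?addr0 // => i /andP[_ /negPf ->].
by rewrite big1 // => i iI; case: eqP => // ij; rewrite -ij iI in jI.
Qed.

(** In characteristic zero this is membership in the polynomial ring on the variables of [U]; the
    differential form passes easily through products and commuting derivatives. *)
Definition free_off U f : Prop := forall j, j \notin U -> f^`M(j) = 0.

(** The analogue of [J_G] for the contracted graph [(U, F)], as an ideal of the polynomial ring on
    the variables of [U] instead of the full ring. *)
Definition power_ideal U F f : Prop :=
  exists2 c : {set 'I_n} -> {mpoly K[n]}, forall I, free_off U (c I) &
    f = \sum_(I : {set 'I_n} | (I \subset U) && (I != set0))
          c I * linear_form I ^+ cut F I.

Lemma power_idealD U F f h :
  power_ideal U F f -> power_ideal U F h -> power_ideal U F (f + h).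
Proof.
case=> c c0 -> [d d0 ->]; exists (fun I => c I + d I).
  by move=> I j jU; rewrite mderivD c0 // d0 // addr0.
by rewrite -big_split; apply: eq_bigr => I _; rewrite mulrDl.
Qed.

Lemma free_off_linear_form U I : I \subset U -> free_off U (linear_form I).
Proof.
move=> IU j jU; rewrite mderiv_linear_form.
by rewrite (negPf (contra (subsetP IU j) jU)).
Qed.

Lemma mderiv_exp_eq0 f j k : f^`M(j) = 0 -> (f ^+ k)^`M(j) = 0.
Proof.
move=> f0; elim: k => [|k IHk]; first by rewrite expr0 -mpolyC1 mderivC.
by rewrite exprS mderivM f0 IHk mul0r mulr0 addr0.
Qed.

Lemma mderiv_expS f j k : (f ^+ k.+1)^`M(j) = f ^+ k * f^`M(j) *+ k.+1.
Proof.
elim: k => [|k IHk]; first by rewrite expr0 mul1r.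
rewrite exprS mderivM IHk mulrnAr mulrA -exprS.
by rewrite mulrC -mulrS.
Qed.

Lemma free_off_power_ideal U F f : power_ideal U F f -> free_off U f.
Proof.
case=> c c0 -> j jU; rewrite raddf_sum big1 //= => I /andP[IU _].
by rewrite mderivM c0 // (mderiv_exp_eq0 _ (free_off_linear_form IU jU)) mul0r mulr0 addr0.
Qed.

(** The generator for [I = U] is a zeroth power, so the ideal is the unit ideal. *)
Lemma power_ideal_uncrossed U F f : U != set0 ->
  (forall e, e \in F -> ~~ crosses U e) -> free_off U f -> power_ideal U F f.
Proof.
move=> U0 noF f0; exists (fun I => f *+ (I == U)).
  by move=> I j jU; rewrite mderivMn f0 // mul0rn.
rewrite (bigD1 U) /= ?subxx // eqxx big1 ?addr0.
  rewrite /cut (_ : [set _ in _ | _] = set0) ?cards0 ?expr0 ?mulr1 //.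
  by apply/setP => e; rewrite !inE; apply/andP => -[/noF/negP].
by move=> I /andP[_ /negPf ->]; rewrite mul0r.
Qed.

Hypothesis char0 : forall k, k.+1%:R != 0 :> K.

Section Step.
Variables (U : {set 'I_n}) (F : {set edge G}) (i : 'I_n) (e : edge G).
Hypotheses (eF : e \in F) (iU : i \in U) (eU : exits U i e).

(** A subset of [U] avoiding [i] is not crossed by [e], so its exponent is unchanged: the generators
    for the contraction are among those for [(U, F)]. *)
Lemma power_ideal_contract f :
  power_ideal (U :\ i) (F :\ e) f -> power_ideal U F f.
Proof.
case=> c c0 ->; exists (fun I => if i \in I then 0 else c I).
  move=> I j jU; case: ifP => _; first by rewrite mderiv0.
  by apply: c0; rewrite !inE negb_and jU orbT.
rewrite [RHS](bigID (fun I : {set 'I_n} => i \in I)) /=.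
rewrite [X in _ = X + _]big1 ?add0r.
  apply: eq_big => [I|I /andP[]]; first by rewrite subsetD1 andbAC.
  rewrite subsetD1 => /andP[IU iI] _.
  by rewrite (cut_step eF eU) // (negPf iI) addn0.
by move=> I /andP[_ ->]; rewrite mul0r.
Qed.

(** Each term is lifted separately. If [i] is in [I], the exponent is one higher in [F] and
    [euler_solve] gives the coefficient; otherwise the power is constant in [x_i] and the
    coefficient is integrated. *)
Lemma power_ideal_delete f : power_ideal U (F :\ e) f ->
  exists2 h, power_ideal U F h & h^`M(i) = f.
Proof.
case=> c c0 ->.
have /fin_all_exists2[d d0 dE] (I : {set 'I_n}) : exists2 h, free_off U h &
    I \subset U -> (h * linear_form I ^+ cut F I)^`M(i)
                   = c I * linear_form I ^+ cut (F :\ e) I.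
  have ineq j : j \notin U -> i != j by apply: contra => /eqP <-.
  have [iI|iI] := boolP (i \in I).
    have s1 : (linear_form I)^`M(i) = 1 by rewrite mderiv_linear_form iI.
    have [h hE h0] := euler_solve char0 (c I) (cut (F :\ e) I) s1.
    (* The value 0 is a default: only subsets of [U] occur in the sum. *)
    have [IU|IU] := boolP (I \subset U); last by exists 0 => // j _; rewrite mderiv0.
    exists h => [j jU|_]; first by apply: h0; [apply: free_off_linear_form IU _ _ | apply: c0].
    rewrite (cut_step eF eU) // iI addn1 mderivM mderiv_expS s1 mulr1.
    by rewrite -hE exprS mulrDl mulrA [h^`M(i) * _]mulrC mulrnAl mulrnAr.
  exists (primitive i (c I)) => [j jU|IU].
    by apply: mderiv_primitive_eq0 => //; [apply: ineq | apply: c0].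
  rewrite (cut_step eF eU) // (negPf iI) addn0 mderivM mderiv_primitive //.
  by rewrite mderiv_exp_eq0 ?mulr0 ?addr0 // mderiv_linear_form (negPf iI).
exists (\sum_(I : {set 'I_n} | (I \subset U) && (I != set0))
          d I * linear_form I ^+ cut F I); first by exists d.
by rewrite raddf_sum; apply: eq_bigr => I /andP[IU _]; apply: dE.
Qed.

End Step.

Lemma power_ideal_span U F f : free_off U f -> exists h p,
  [/\ f = h + p, power_ideal U F h & {subset msupp p <= park U F}].
Proof.
have PI0 W E : power_ideal W E 0.
  exists (fun=> 0) => [I j _|]; first exact: mderiv0.
  by rewrite big1 // => I _; rewrite mul0r.
move: U F f; apply: deletion_contraction_ind => [F f f0|U F U0 noF f f0|].
- exists 0, f; split; rewrite ?add0r // => m mf.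
  rewrite -topredE /= park_set0; apply/eqP/mnmP => k; rewrite mnm0E.
  have /f0 : k \notin set0 by rewrite inE.
  by move/(mderiv_eq0P char0); apply.
- exists f, 0; split; rewrite ?addr0 ?msupp0 //.
  exact: power_ideal_uncrossed.
move=> U F i e eF iU eU IHdel IHcon f f0.
have [|h' [p' [fE Ph' Sp']]] := IHdel f^`M(i).
  by move=> j jU; rewrite mderiv_comm f0 // mderiv0.
have [h Ph hE] := power_ideal_delete eF iU eU Ph'.
pose p := primitive i p'.
have Sp : {subset msupp p <= park U F}.
  move=> m /msupp_primitive[m' /Sp' m'P ->].
  by rewrite -topredE /= (park_delete eF iU eU).
(* The derivative in [x_i] of this difference vanishes, so it lives on [U :\ i]. *)
have [|h2 [p2 [f2E Ph2 Sp2]]] := IHcon (f - h - p).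
  move=> j; rewrite !inE negb_and negbK => /orP[/eqP->|jU].
    by rewrite !mderivB hE mderiv_primitive // fE [h' + p']addrC addrK subrr.
  rewrite !mderivB f0 // (free_off_power_ideal Ph) // sub0r oppr0 sub0r.
  apply/eqP; rewrite oppr_eq0; apply/eqP; apply/(mderiv_eq0P char0) => m /Sp.
  by case/parkP => /(_ j jU).
exists (h + h2), (p + p2); split.
- by rewrite addrACA -f2E -[f - h - p]addrA -opprD addrC subrK.
- by apply: power_idealD => //; apply: (power_ideal_contract eF eU).
- move=> m /msuppD_le; rewrite mem_cat => /orP[/Sp //|/Sp2].
  rewrite -!topredE /= => mP; rewrite (park_contract eF eU) //.
  by have /parkP[/(_ i)] := mP; rewrite !inE eqxx => /(_ isT).
Qed.

(** * Differential functionals along edges, and independence *)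

(** The root has no variable, as if [x_0 = 0]; its derivation is zero. *)
Definition vderiv (u : 'I_n.+1) f : {mpoly K[n]} :=
  if unlift ord0 u is Some j then f^`M(j) else 0.

(** An arbitrary orientation of the edges; for a loop, the default in [end2] makes both ends
    equal. *)
Definition end1 e : 'I_n.+1 := odflt ord0 [pick u in ends e].
Definition end2 e : 'I_n.+1 := odflt (end1 e) [pick u in ends e :\ end1 e].

Lemma ends12 e : ends e = [set end1 e; end2 e].
Proof.
have /andP[e0 e2] := card_ends e.
have e1 : end1 e \in ends e.
  by rewrite /end1; case: pickP => //= none; move: e0; rewrite (eq_card0 none).
rewrite /end2; move: e2; rewrite -{1 2}(setD1K e1) (cardsD1 (end1 e)) setU11.
rewrite setU1K ?setD11 //; case: pickP => /= [v ve|none _].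
  by rewrite (cardsD1 v) ve ltnS ltnS leqn0 cards_eq0 => /eqP ev;
    rewrite -(setD1K ve) ev setU0.
by rewrite setUid (_ : _ :\ _ = set0) ?setU0 //; apply/setP => v; rewrite none inE.
Qed.

Definition ederiv e f : {mpoly K[n]} := vderiv (end1 e) f - vderiv (end2 e) f.

Lemma vderivM u f h : vderiv u (f * h) = vderiv u f * h + f * vderiv u h.
Proof.
by rewrite /vderiv; case: unlift => [j|]; rewrite ?mderivM // mul0r mulr0 addr0.
Qed.

Lemma ederivM e f h : ederiv e (f * h) = ederiv e f * h + f * ederiv e h.
Proof. by rewrite /ederiv !vderivM mulrBl mulrBr opprD addrACA. Qed.

Lemma ederiv_zmod e : zmod_morphism (ederiv e).
Proof.
have vB u f h : vderiv u (f - h) = vderiv u f - vderiv u h.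
  by rewrite /vderiv; case: unlift => [j|]; rewrite ?mderivB // subr0.
by move=> f h; rewrite /ederiv !vB !opprD addrACA.
Qed.

Lemma vderiv_linear_form u I : vderiv u (linear_form I) = (u \in @vtx n @: I)%:R.
Proof.
rewrite /vderiv; case: unliftP => [j ->|->].
  by rewrite mderiv_linear_form mem_vtx.
by rewrite (negPf (root_notin_vtx _)).
Qed.

Lemma ederiv_linear_form e I : ~~ crosses I e -> ederiv e (linear_form I) = 0.
Proof.
rewrite (crossesE _ (ends12 e)) negbK => /eqP E.
by rewrite /ederiv !vderiv_linear_form E subrr.
Qed.

(** By the Leibniz rule a derivation costs at most one factor of the power, and none when [e] does
    not cross [I], since the linear form is then killed. For [k = 0] the subtraction is
    truncated. *)
Lemma ederiv_linear_form_exp e I c k : exists c',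
  ederiv e (c * linear_form I ^+ k) = c' * linear_form I ^+ (k - crosses I e).
Proof.
have dX : ederiv e (linear_form I ^+ k)
    = ederiv e (linear_form I) * linear_form I ^+ k.-1 *+ k.
  elim: k => [|k IHk].
    rewrite expr0 /ederiv /vderiv -mpolyC1.
    by do 2?case: unlift => [?|]; rewrite ?mderivC subrr.
  rewrite exprS ederivM IHk; case: k {IHk} => [|k].
    by rewrite mulr0 addr0.
  by rewrite mulrnAr mulrCA -exprS -mulrS.
rewrite ederivM dX; have [eI|/ederiv_linear_form->] := boolP (crosses I e).
  case: k {dX} => [|k]; first by rewrite mulr0n mulr0 addr0; exists (ederiv e c).
  exists (ederiv e c * linear_form I + c * ederiv e (linear_form I) *+ k.+1).
  by rewrite subn1 /= [RHS]mulrDl -mulrA -exprS mulrnAr mulrnAl -mulrA.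
by rewrite subn0 mul0r mul0rn mulr0 addr0; exists (ederiv e c).
Qed.

Definition ederivs (s : seq (edge G)) f : {mpoly K[n]} :=
  foldl (fun h e => ederiv e h) f s.

Lemma ederivs_zmod s : zmod_morphism (ederivs s).
Proof.
elim: s => [//|e s IHs] f h; rewrite /ederivs /= ederiv_zmod; exact: IHs.
Qed.

HB.instance Definition _ s :=
  GRing.isZmodMorphism.Build _ _ (ederivs s) (ederivs_zmod s).

Lemma ederivs_linear_form_exp s I c k : exists c',
  ederivs s (c * linear_form I ^+ k) = c' * linear_form I ^+ (k - count (crosses I) s).
Proof.
elim: s c k => [|e s IHs] c k; first by exists c; rewrite subn0.
have [c' /= ->] := ederiv_linear_form_exp e I c k.
by have [c2 ->] := IHs c' (k - crosses I e)%N; exists c2; rewrite subnDA.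
Qed.

Lemma ederivs_gen_ideal s f : uniq s -> crossed (~: [set e in s]) [set: 'I_n] ->
  f \in gen_ideal (@nonempty n) (pI G K) -> (ederivs s f)@_0 = 0.
Proof.
move=> s_uniq /crossedP sX /gen_idealP[c ->]; rewrite !raddf_sum big1 //= => I I0.
have [e es eI] := sX I (subsetT _) I0; rewrite !inE in es.
rewrite pIE; have [c' ->] := ederivs_linear_form_exp s I (c I) (cut [set: edge G] I).
(* The inequality is strict because [e] crosses [I] without being in [s]; a factor of the linear
   form survives and vanishes at 0. *)
have : (count (crosses I) s < cut [set: edge G] I)%N.
  rewrite -size_filter -(card_uniqP (filter_uniq _ s_uniq)).
  apply: proper_card; apply/properP; split.
    by apply/subsetP => f'; rewrite mem_filter !inE => /andP[].
  by exists e; rewrite ?inE ?eI // mem_filter (negPf es) andbF.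
rewrite -subn_gt0; case: (_ - _)%N => // k _.
rewrite exprS mulrCA rmorphM /= raddf_sum big1 ?mul0r //= => i _.
by rewrite mcoeffX mnm1_eq0.
Qed.

(** The far end of [e] is the root or a vertex whose variable [f] does not involve; the sign depends
    on the orientation of [e]. *)
Lemma ederiv_step U i e f : i \in U -> exits U i e -> free_off U f ->
  ederiv e f = f^`M(i) \/ ederiv e f = - f^`M(i).
Proof.
move=> iU /existsP[w /andP[wU /eqP eE]] f0.
have vw : vderiv w f = 0.
  rewrite /vderiv; case: unliftP => // j wj; apply: f0.
  by apply: contra wU => jU; rewrite wj mem_vtx.
have vi : vderiv (vtx i) f = f^`M(i) by rewrite /vderiv liftK.
have iw : vtx i != w by apply: contraNneq wU => <-; rewrite mem_vtx.
have : vtx i \in [set end1 e; end2 e] by rewrite -ends12 eE set21.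
have : w \in [set end1 e; end2 e] by rewrite -ends12 eE set22.
rewrite !inE /ederiv => /orP[]/eqP <- /orP[]/eqP E.
- by rewrite E eqxx in iw.
- by right; rewrite -E vw vi sub0r.
- by left; rewrite -E vw vi subr0.
- by rewrite E eqxx in iw.
Qed.

Lemma park_indep U F f : {subset msupp f <= park U F} ->
    (forall s, uniq s -> {subset s <= F} -> crossed (F :\: [set e in s]) U ->
       (ederivs s f)@_0 = 0) ->
  f = 0.
Proof.
move: U F f; apply: deletion_contraction_ind => [F f fP f0|U F U0 noF f fP _|].
- apply/mpolyP => m; rewrite mcoeff0; have [/fP|] := boolP (m \in msupp f).
    rewrite -topredE /= park_set0 => /eqP ->; apply: (f0 [::]) => //.
    by apply/crossedP => I; rewrite subset0 => ->.
  exact: memN_msupp_eq0.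
- apply/mpolyP => m; rewrite mcoeff0; apply: memN_msupp_eq0.
  by apply/negP => /fP; apply/negP; apply: park_uncrossed.
move=> U F i e eF iU eU IHdel IHcon f fP f0.
have fU : free_off U f.
  by move=> j jU; apply/(mderiv_eq0P char0) => m /fP/parkP[/(_ j jU)].
(* Functionals using [e]: prepending [e] to a list [s] for the deletion leaves the same complement,
   and evaluates [s] on the derivative of [f] up to sign. *)
have df0 : f^`M(i) = 0.
  apply: IHdel => [m|s s_uniq sF sX].
    rewrite mcoeff_msupp mcoeff_deriv => mf; rewrite -topredE /=.
    rewrite -(park_delete eF iU eU); apply: fP; rewrite mcoeff_msupp.
    by apply: contraNneq mf => ->; rewrite mul0rn.
  have es : e \notin s by apply/negP => /sF; rewrite setD11.
  have := f0 (e :: s); rewrite /= es s_uniq => /(_ isT).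
  have -> : F :\: [set x in e :: s] = (F :\ e) :\: [set x in s].
    by apply/setP => x; rewrite !inE negb_or -andbA andbCA.
  move=> /(_ _ sX) H; have {H} : (ederivs s (ederiv e f))@_0 = 0.
    by apply: H => x; rewrite inE => /orP[/eqP->//|/sF]; rewrite !inE => /andP[].
  have [->|->] // := ederiv_step iU eU fU.
  by rewrite !raddfN /= => /eqP; rewrite oppr_eq0 => /eqP.
(* Functionals avoiding [e]: now [e] stays in the complement, where it can be contracted. *)
apply: IHcon => [m mf|s s_uniq sF sX].
  rewrite -topredE /= -(park_contract eF eU); first exact: fP.
  by move/(mderiv_eq0P char0): df0 => /(_ m mf).
have es : e \notin s by apply/negP => /sF; rewrite setD11.
apply: f0 => // [x /sF|]; first by rewrite !inE => /andP[].
have -> : F :\: [set x in s] = e |: ((F :\ e) :\: [set x in s]).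
  apply/setP => x; rewrite !inE; case: eqP => [->|]; last by [].
  by rewrite es eF.
by rewrite (crossed_step eU) // !inE eqxx andbF.
Qed.

Lemma pI_indep f : f \in gen_ideal (@nonempty n) (pI G K) ->
  {subset msupp f <= is_parking G} -> f = 0.
Proof.
move=> fI fP; apply: (@park_indep [set: 'I_n] [set: edge G]) => [m /fP|s s_uniq _ sX].
  by rewrite -!topredE /= is_parkingE.
by apply: ederivs_gen_ideal; rewrite // -setTD.
Qed.

Lemma pI_span f : exists2 p, f - p \in gen_ideal (@nonempty n) (pI G K) &
  {subset msupp p <= is_parking G}.
Proof.
have [|h [p [-> [c _ hE] pP]]] := @power_ideal_span [set: 'I_n] [set: edge G] f.
  by move=> j; rewrite inE.
exists p => [|m /pP]; last by rewrite -!topredE /= is_parkingE.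
rewrite addrK; apply/gen_idealP; exists c; rewrite hE.
by apply: eq_big => [I|I _]; rewrite ?subsetT ?pIE.
Qed.

End PowerIdeal.

(* The claims on B_G can fail in positive characteristic: for the triangle and
   char K = 2, B_G = K[x_1, x_2] / (x_1 ^ 2, x_2 ^ 2) has dimension 4, not 3. *)
Theorem theorem3p1 (n : nat) (G : multigraph n) (K : fieldType) :
  (fin_dim (whole (algA G K)) /\
   has_dim (whole (algA G K)) (num_spanning_trees G)) /\
  ([pchar K] =i pred0 ->
   [/\ basis_on (whole (algB G K)) (parking_monomial (G := G) K),
       exists h : nat -> nat, hilbert_series_A G K h /\ hilbert_series_B G K h,
       fin_dim (whole (algB G K)) &
       has_dim (whole (algB G K)) (num_spanning_trees G)]).
Proof.
(* The same list [s] indexes a monomial basis of both algebras, which gives the common dimension and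
   Hilbert series. *)
have [s [s_uniq sP s_size]] := @park_enum n G [set: 'I_n] [set: edge G].
have {}sP : s =i is_parking G by move=> b; rewrite sP -!topredE /= is_parkingE.
rewrite num_spanning_treesE -s_size.
have indepA f : f \in gen_ideal (@nonempty n) (mI G K) ->
    {subset msupp f <= s} -> f = 0.
  by move=> fI fs; apply: mI_indep fI _ => m /fs; rewrite sP.
have spanA f : exists2 p, f - p \in gen_ideal (@nonempty n) (mI G K) &
    {subset msupp p <= s}.
  by have [p fp pP] := mI_span G f; exists p => // m /pP; rewrite sP.
have dimA : has_dim (whole (algA G K)) (size s) by apply: has_dim_quot.
split=> [|/pcharf0P char0]; first by split=> //; exists (size s).
have {}char0 k : k.+1%:R != 0 :> K by rewrite char0.
have indepB f : f \in gen_ideal (@nonempty n) (pI G K) ->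
    {subset msupp f <= s} -> f = 0.
  by move=> fI fs; apply: (pI_indep char0 fI) => m /fs; rewrite sP.
have spanB f : exists2 p, f - p \in gen_ideal (@nonempty n) (pI G K) &
    {subset msupp p <= s}.
  by have [p fp pP] := pI_span G char0 f; exists p => // m /pP; rewrite sP.
have dimB : has_dim (whole (algB G K)) (size s) by apply: has_dim_quot.
split=> //; last by exists (size s).
  apply: (monomial_basis_on (phi := val)) => // [|f fI fP|v _].
  - exact: val_inj.
  - by apply: (pI_indep char0 fI) => m /fP[b <-]; apply: valP.
  - have [f ->] := quot_pi_surj v; have [p fp pP] := pI_span G char0 f.
    exists p; first by apply/eqP; rewrite quot_pi_eq.
    by move=> m /pP mP; exists (Sub m mP); rewrite SubK.
exists (fun k => size [seq m <- s | mdeg m == k]); split.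
  by apply: hilbert_series_quot => // I _; apply: mI_homog.
by apply: hilbert_series_quot => // I _; apply: pI_homog.
Qed.
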